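(* Let $S$ be a finite set, let $\Gamma$ be an arbitrary Coxeter graph over $S$ with Coxeter matrix $(m_{s,t})_{s,t\in S}$, and let $A(\Gamma)$ be the associated Artin group with standard generators $\{\sigma_s : s\in S\}$. Then the set of squares of the Artin generators, $\mathcal{Q}=\{Q_s=\sigma_s^2 : s\in S\}$, generates a subgroup of $A(\Gamma)$ with presentation $$\langle \mathcal{Q}\mid Q_sQ_t=Q_tQ_s \text{ if } m_{s,t}=2\rangle .$$ That is, the homomorphism to $A(\Gamma)$ from the abstract group with generators $Q_s$ ($s\in S$) and defining relations $Q_sQ_t=Q_tQ_s$ for all $s,t\in S$ with $m_{s,t}=2$, which sends $Q_s$ to $\sigma_s^{2}$ for each $s\in S$, is injective.
   Context: A Coxeter matrix over a finite set $S$ is a matrix $M=(m_{s,t})_{s,t\in S}$ with $m_{s,s}=1$ for all $s\in S$ and $m_{s,t}=m_{t,s}\in\{2,3,4,\dots\}\cup\{\infty\}$ for all $s\neq t$. It is represented by its Coxeter graph $\Gamma$: the vertex set is $S$; distinct $s,t$ are joined by an edge iff $m_{s,t}\neq 2$; the edge is labelled $m_{s,t}$ if $m_{s,t}\geq 4$ or $m_{s,t}=\infty$. For letters $a,b$ and $m\in\mathbb{N}$ let $\mathrm{prod}(a,b;m)=(ab)^{m/2}$ if $m$ is even and $(ab)^{(m-1)/2}a$ if $m$ is odd. The Artin group is $$A(\Gamma)=\langle \sigma_s\ (s\in S)\mid \mathrm{prod}(\sigma_s,\sigma_t;m_{s,t})=\mathrm{prod}(\sigma_t,\sigma_s;m_{s,t})\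 \text{for all } s,t\in S \text{ with } m_{s,t}\neq\infty\rangle .$$ *)

(* Defs.v *)
From HB Require Import structures.
From mathcomp Require Import all_boot.
From mathcomp Require Import boolp.

Set Implicit Arguments.
Unset Strict Implicit.
Unset Printing Implicit Defensive.

Import Algebra.
Local Open Scope group_scope.
Local Open Scope quotient_scope.

(* Group words over [S]: the letter (s, true) stands for s, and (s, false) for
   the formal inverse of s. *)
Notation word S := (seq (S * bool)).

Definition pos_letter (S : Type) (s : S) : S * bool := (s, true).

(* The congruence whose classes are the elements of < S | u = v for R u v >. *)
Inductive pres_eq (S : Type) (R : word S -> word S -> Prop) :
    word S -> word S -> Prop :=
| pres_refl u : pres_eq R u u
| pres_sym u v : pres_eq R u v -> pres_eq R v u
| pres_trans u v w : pres_eq R u v -> pres_eq R v w -> pres_eq R u w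
| pres_cat u u' v v' :
    pres_eq R u u' -> pres_eq R v v' -> pres_eq R (u ++ v) (u' ++ v')
| pres_cancel s b : pres_eq R [:: (s, b); (s, ~~ b)] [::]
| pres_rel u v : R u v -> pres_eq R u v.

Section PresentedGroup.
Variables (S : choiceType) (R : word S -> word S -> Prop).

Definition pres_eqb (u v : word S) : bool := `[< pres_eq R u v >].

Lemma pres_eqb_refl : reflexive pres_eqb.
Proof. by move=> u; apply/asboolP; apply: pres_refl. Qed.

Lemma pres_eqb_sym : symmetric pres_eqb.
Proof.
by move=> u v; apply/idP/idP => /asboolP uv; apply/asboolP; apply: pres_sym.
Qed.

Lemma pres_eqb_trans : transitive pres_eqb.
Proof.
move=> v u w /asboolP uv /asboolP vw; apply/asboolP.
exact: pres_trans uv vw.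
Qed.

Canonical pres_equiv :=
  EquivRel pres_eqb pres_eqb_refl pres_eqb_sym pres_eqb_trans.

Definition presented_group : Type := {eq_quot pres_equiv}.

HB.instance Definition _ := Choice.on presented_group.

Definition pres_class (u : word S) : presented_group := \pi_({eq_quot pres_equiv}) u.

Definition pres_repr (x : presented_group) : word S :=
  repr (x : {eq_quot pres_equiv}).

Lemma pres_reprK : cancel pres_repr pres_class.
Proof. exact: reprK. Qed.

Lemma pres_classP u v : pres_class u = pres_class v <-> pres_eq R u v.
Proof.
split=> [/eqmodP uv | uv]; first exact/asboolP.
by apply/eqmodP; apply/asboolP.
Qed.

Lemma pres_repr_class u : pres_eq R (pres_repr (pres_class u)) u.
Proof. by apply/pres_classP; rewrite pres_reprK. Qed.

Definition word_inv (u : word S) : word S :=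
  rev [seq (l.1, ~~ l.2) | l <- u].

Lemma word_invK : involutive word_inv.
Proof.
move=> u; rewrite /word_inv map_rev revK -map_comp -[RHS]map_id.
by apply: eq_map => -[s b] /=; rewrite negbK.
Qed.

Lemma word_invr u : pres_eq R (u ++ word_inv u) [::].
Proof.
elim: u => [|[s b] u IHu]; first exact: pres_refl.
rewrite /word_inv /= rev_cons -cats1 catA -cat1s.
apply: pres_trans (pres_cancel R s b).
rewrite -[[:: (s, b); (s, ~~ b)]]/([:: (s, b)] ++ ([::] ++ [:: (s, ~~ b)])).
rewrite -[(_ :: _) ++ _ ++ _]/([:: (s, b)] ++ ((u ++ word_inv u) ++ _)).
by do 2![apply: pres_cat; try exact: pres_refl].
Qed.

Lemma word_invl u : pres_eq R (word_inv u ++ u) [::].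
Proof. by have := word_invr (word_inv u); rewrite word_invK. Qed.

Lemma pres_eq_inv u v : pres_eq R u v -> pres_eq R (word_inv u) (word_inv v).
Proof.
move=> uv; have ivu : pres_eq R (v ++ word_inv u) [::].
  apply: pres_trans (word_invr u); apply: pres_cat; last exact: pres_refl.
  exact: pres_sym.
apply: pres_sym; rewrite -[word_inv v]cats0.
apply: pres_trans (_ : pres_eq R (word_inv v ++ (v ++ word_inv u)) _).
  by apply: pres_cat; [exact: pres_refl | exact: pres_sym].
rewrite catA -[X in pres_eq R _ X]cat0s.
by apply: pres_cat; [exact: word_invl | exact: pres_refl].
Qed.

Definition pres_one := pres_class [::].
Definition pres_mul x y := pres_class (pres_repr x ++ pres_repr y).
Definition pres_inv x := pres_class (word_inv (pres_repr x)).

Lemma pres_mulE u v :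
  pres_mul (pres_class u) (pres_class v) = pres_class (u ++ v).
Proof. by apply/pres_classP; apply: pres_cat; exact: pres_repr_class. Qed.

Lemma pres_invE u : pres_inv (pres_class u) = pres_class (word_inv u).
Proof. by apply/pres_classP; apply: pres_eq_inv; exact: pres_repr_class. Qed.

Lemma pres_mulA : associative pres_mul.
Proof.
move=> x y z; rewrite -[x]pres_reprK -[y]pres_reprK -[z]pres_reprK.
by rewrite !pres_mulE catA.
Qed.

Lemma pres_mul1g : left_id pres_one pres_mul.
Proof. by move=> x; rewrite -[x]pres_reprK pres_mulE. Qed.

Lemma pres_mulg1 : right_id pres_one pres_mul.
Proof. by move=> x; rewrite -[x]pres_reprK pres_mulE cats0. Qed.

Lemma pres_mulVg : left_inverse pres_one pres_inv pres_mul.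
Proof.
move=> x; rewrite -[x]pres_reprK pres_invE pres_mulE.
by apply/pres_classP; exact: word_invl.
Qed.

Lemma pres_mulgV : right_inverse pres_one pres_inv pres_mul.
Proof.
move=> x; rewrite -[x]pres_reprK pres_invE pres_mulE.
by apply/pres_classP; exact: word_invr.
Qed.

HB.instance Definition _ := isGroup.Build presented_group
  pres_mulA pres_mul1g pres_mulg1 pres_mulVg pres_mulgV.

Definition pres_gen (s : S) : presented_group := pres_class [:: pos_letter s].

Lemma pres_classM u v : pres_class (u ++ v) = pres_class u * pres_class v.
Proof. by symmetry; exact: pres_mulE. Qed.

Lemma pres_class_letter s b :
  pres_class [:: (s, b)] = if b then pres_gen s else (pres_gen s)^-1.
Proof. by case: b => //; symmetry; exact: pres_invE. Qed.

Section UniversalProperty.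
Variable G : groupType.

Definition eval_word (f : S -> G) (u : word S) : G :=
  \prod_(l <- u) (if l.2 then f l.1 else (f l.1)^-1).

Definition respects_rel (f : S -> G) : Prop :=
  forall u v, R u v -> eval_word f u = eval_word f v.

Lemma eval_word_cat f u v :
  eval_word f (u ++ v) = eval_word f u * eval_word f v.
Proof. exact: big_cat. Qed.

Lemma eval_word_pres f u v :
  respects_rel f -> pres_eq R u v -> eval_word f u = eval_word f v.
Proof.
move=> fR; elim=> {u v} [u | u v _ -> | u v w _ -> _ -> | u u' v v' _ Eu _ Ev
                        | s b | u v /fR] //.
  by rewrite !eval_word_cat Eu Ev.
by rewrite /eval_word !big_cons big_nil mulg1; case: b; rewrite ?mulgV ?mulVg.
Qed.

(* The morphism of the universal property; it depends on the proof that [f]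
   respects the relations so as to carry a morphism structure. *)
Definition pres_lift (f : S -> G) of respects_rel f :=
  fun x : presented_group => eval_word f (pres_repr x).

Section Lift.
Variables (f : S -> G) (fR : respects_rel f).

Lemma pres_lift_class u : pres_lift fR (pres_class u) = eval_word f u.
Proof. by apply: eval_word_pres => //; exact: pres_repr_class. Qed.

Lemma pres_lift_monoid_morphism : monoid_morphism (pres_lift fR).
Proof.
split; first by rewrite [LHS](pres_lift_class [::]) /eval_word big_nil.
move=> x y; rewrite -[x]pres_reprK -[y]pres_reprK -pres_classM.
by rewrite !pres_lift_class eval_word_cat.
Qed.

HB.instance Definition _ :=
  isUMagmaMorphism.Build presented_group G (pres_lift fR)
    pres_lift_monoid_morphism.

Lemma pres_lift_gen s : pres_lift fR (pres_gen s) = f s.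
Proof.
by rewrite pres_lift_class /eval_word big_cons big_nil mulg1.
Qed.

Lemma pres_lift_unique (g : UMagmaMorphism.type presented_group G) :
  (forall s, g (pres_gen s) = f s) -> g =1 pres_lift fR.
Proof.
move=> gf x; rewrite -[x]pres_reprK; elim: (pres_repr x) => [|[s b] u IHu].
  by transitivity (1 : G); [exact: gmulf1 | symmetry; exact: gmulf1].
rewrite -cat1s pres_classM !gmulfM IHu pres_class_letter; congr (_ * _).
have Egen : g (pres_gen s) = pres_lift fR (pres_gen s).
  by rewrite gf pres_lift_gen.
by case: b => //; transitivity (g (pres_gen s))^-1;
  [exact: gmulfV | rewrite Egen; symmetry; exact: gmulfV].
Qed.

End Lift.
End UniversalProperty.
End PresentedGroup.

Arguments pres_gen {S} R s.

(* [None] encodes the label infinity. *)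
Record coxeter_matrix (S : finType) := CoxeterMatrix {
  cox_entry :> S -> S -> option nat;
  cox_diag : forall s, cox_entry s s = Some 1%N;
  cox_sym : forall s t, cox_entry s t = cox_entry t s;
  cox_offdiag : forall s t m, s != t -> cox_entry s t = Some m -> (2 <= m)%N
}.

(* prod(s, t; m) = s t s ... with m letters *)
Definition prod_word (S : Type) (s t : S) (m : nat) : word S :=
  flatten (nseq m./2 [:: pos_letter s; pos_letter t])
    ++ nseq (odd m) (pos_letter s).

Section Artin.
Variables (S : finType) (M : coxeter_matrix S).

Inductive artin_rel : word S -> word S -> Prop :=
| ArtinRel s t m of M s t = Some m :
    artin_rel (prod_word s t m) (prod_word t s m).

Definition artin_group : Type := presented_group artin_rel.
HB.instance Definition _ := Group.on artin_group.

Definition sigma (s : S) : artin_group := pres_gen artin_rel s.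

Inductive square_rel : word S -> word S -> Prop :=
| SquareRel s t of M s t = Some 2%N :
    square_rel [:: pos_letter s; pos_letter t] [:: pos_letter t; pos_letter s].

Definition square_group : Type := presented_group square_rel.
HB.instance Definition _ := Group.on square_group.

Definition Q (s : S) : square_group := pres_gen square_rel s.

Lemma artin_commute s t : M s t = Some 2%N -> commute (sigma s) (sigma t).
Proof.
move=> Mst; rewrite /commute /sigma /pres_gen.
rewrite -[LHS]pres_classM -[RHS]pres_classM; apply/pres_classP.
exact/pres_rel/(ArtinRel Mst).
Qed.

Lemma sigma_sqr_respects : respects_rel square_rel (fun s => sigma s ^+ 2).
Proof.
move=> _ _ [s t Mst]; rewrite /eval_word !big_cons big_nil !mulg1 /=.
exact/commuteX2/artin_commute.
Qed.

(* the morphism Q_s |-> sigma_s ^+ 2 *)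
Definition square_hom : square_group -> artin_group :=
  pres_lift sigma_sqr_respects.

HB.instance Definition _ := UMagmaMorphism.on square_hom.

Lemma square_homQ s : square_hom (Q s) = sigma s ^+ 2.
Proof. exact: pres_lift_gen. Qed.

Lemma square_hom_unique (g : UMagmaMorphism.type square_group artin_group) :
  (forall s, g (Q s) = sigma s ^+ 2) -> g =1 square_hom.
Proof. exact: pres_lift_unique. Qed.

End Artin.

Arguments sigma {S} M s.
Arguments Q {S} M s.
Arguments square_hom {S} M x.

(* Main.v *)
Require Import Defs.
From HB Require Import structures.
From mathcomp Require Import all_boot.
From mathcomp Require Import boolp.
From mathcomp Require Import zify.

(** The squares are shown to satisfy no relations beyond the evident ones by
    letting the Artin group act on a free group and playing ping-pong.

    If all the labels of a Coxeter graph are 2 or 3, take an annulus for each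
    vertex and plumb the annuli of adjacent vertices at a square.  The Dehn
    twists along the core circles of the annuli satisfy the Artin relations,
    so the Artin group acts on the fundamental groupoid of the resulting
    surface.  When the graph is bipartite this action has a purely algebraic
    description: the circle of the vertex v is cut by its crossings into
    letters (v, w), one for each vertex w, and the twist along the circle of v
    multiplies the letter (u, v) of each neighbour u on the left by the word
    that runs once around the circle of v from the crossing with u, forwards
    or backwards according to the colour class of v; it fixes all other
    letters.  These are automorphisms of a free group, they commute when the
    vertices are not adjacent and satisfy the braid relation when they are
    (twist_bij_commute, twist_bij_braid).

    The main point is that twists cause almost no cancellation.  Twisting
    along the circle of v replaces each maximal run of letters of that circle
    in a reduced word by another run, and the result becomes reduced once each
    run has been reduced (nf_insert_gap).  Hence, if a reduced word runs around
    the circle of v so far that it goes straight across each of the circles it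
    meets, and u is adjacent to v, then twisting n times along the circle of u
    inserts n full turns around that circle at the crossing.  For |n| at least
    2 these turns again go straight across everything that this circle meets;
    for |n| = 1 they need not, which is why squares are taken.  So the powers
    of the twist of u with exponent at least 2 in absolute value send the
    elements twisted along v to elements twisted along u (twisted_enter), while
    twists along circles that do not meet the circle of v leave the turns
    around it unchanged (twisted_keep).  This is the ping-pong situation for a
    right-angled Artin group (ping_pong).

    General labels are reduced to this case by unfolding.  Each generator s is
    replaced by many commuting copies, placed so that the copies of s and of t
    form disjoint paths with m(s, t) - 1 vertices, with colours alternating
    along each path; s acts as the product of the twists of its copies.  The
    relation of length m between s and t then follows from the braid relations
    along a path with m - 1 vertices, where both alternating products are the
    Garside half-twist of the braid group on m strands (path_alt_comm).  A
    label infinity imposes nothing, and is treated like a label 3. *)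

Set Implicit Arguments.
Unset Strict Implicit.
Unset Printing Implicit Defensive.

Import Algebra.
Local Open Scope group_scope.

(** * Alternating products and the braid relations of a path *)

Section Alternating.
Variable G : groupType.
Implicit Types x y : G.

(** The product prod(x, y; n) of the Artin relations. *)
Fixpoint alt x y n := if n is n'.+1 then x * alt y x n' else 1.

Definition alt_comm n x y := alt x y n = alt y x n.

Lemma altSr x y n : alt x y n.+1 = alt x y n * (if odd n then y else x).
Proof.
elim: n x y => [|n IHn] x y; first by rewrite /= mulg1 mul1g.
by rewrite -[LHS]/(x * alt y x n.+1) IHn mulgA /=; case: (odd n).
Qed.

Lemma commute_alt x y z n : commute z x -> commute z y -> commute z (alt x y n).
Proof.
elim: n x y => [|n IHn] x y zx zy; first exact: commute1.
by apply: commuteM => //; exact: IHn.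
Qed.

Lemma alt_mul x y x' y' n :
    commute x x' -> commute x y' -> commute y x' -> commute y y' ->
  alt (x * x') (y * y') n = alt x y n * alt x' y' n.
Proof.
elim: n x y x' y' => [|n IHn] x y x' y' xx' xy' yx' yy'; first by rewrite mulg1.
rewrite /= IHn // -!mulgA; congr (_ * _); rewrite !mulgA; congr (_ * _).
exact: commute_alt (commute_sym yx') (commute_sym xx').
Qed.

Lemma alt_commM n x y x' y' :
    commute x x' -> commute x y' -> commute y x' -> commute y y' ->
  alt_comm n x y -> alt_comm n x' y' -> alt_comm n (x * x') (y * y').
Proof.
by move=> xx' xy' yx' yy' xy x'y'; rewrite /alt_comm !alt_mul // xy x'y'.
Qed.

(** Relations between alternating products survive commuting products; this is
    what turns relations along disjoint paths into an Artin relation. *)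
Lemma alt_comm_prod (I : eqType) (r : seq I) (x y : I -> G) n :
    uniq r ->
    (forall i j, i != j ->
      [/\ commute (x i) (x j), commute (x i) (y j) & commute (y i) (y j)]) ->
    (forall i, i \in r -> alt_comm n (x i) (y i)) ->
  alt_comm n (\prod_(i <- r) x i) (\prod_(i <- r) y i).
Proof.
move=> + cxy; elim: r => [|i r IHr] /=; first by rewrite !big_nil.
case/andP=> ir /IHr{}IHr xy; rewrite !big_cons.
have cir j : j \in r ->
  [/\ commute (x i) (x j), commute (x i) (y j), commute (y i) (x j)
    & commute (y i) (y j)].
  move=> jr; have ij : i != j by apply: contraNneq ir => ->.
  have ji : j != i by rewrite eq_sym.
  have [? ? ?] := cxy _ _ ij; have [_ ? _] := cxy _ _ ji.
  by split=> //; exact: commute_sym.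
apply: alt_commM; try by rewrite big_seq; apply: commute_prod => j /cir[].
  by apply: xy; rewrite mem_head.
by apply: IHr => j jr; apply: xy; rewrite inE jr orbT.
Qed.

End Alternating.

Section PathRelation.
Variables (G : groupType) (l : nat) (g : nat -> G).
Hypothesis g_far : forall i j, (i.+1 < j)%N -> commute (g i) (g j).
Hypothesis g_near :
  forall i, (i.+1 < l)%N -> g i * g i.+1 * g i = g i.+1 * g i * g i.+1.

(** In the group of braids generated by a path, [parity_row] is one row of a
    brick wall, that is the product of every other generator, and [stair] is
    the braid in which one strand crosses all its successors. *)
Definition parity_row a b k := \prod_(a <= j < b | odd j == odd k) g j.
Definition stair a b := \prod_(a <= j < b) g j.

Lemma row_odd a b k k' : odd k = odd k' -> parity_row a b k = parity_row a b k'.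
Proof. by rewrite /parity_row => ->. Qed.

Lemma row_cat a b c k :
  (a <= b)%N -> (b <= c)%N ->
  parity_row a c k = parity_row a b k * parity_row b c k.
Proof. by move=> ab bc; rewrite /parity_row (big_cat_nat (n := b)). Qed.

Lemma row_nil a b k : (b <= a)%N -> parity_row a b k = 1.
Proof. by move=> ba; rewrite /parity_row big_geq. Qed.

Lemma row1 a k : parity_row a a.+1 k = if odd a == odd k then g a else 1.
Proof. by rewrite /parity_row big_mkcond big_nat1. Qed.

Lemma stairSr a b : (a <= b)%N -> stair a b.+1 = stair a b * g b.
Proof. by move=> ab; rewrite /stair big_nat_recr. Qed.

Lemma far_stair a b j : (b < j)%N -> commute (stair a b) (g j).
Proof.
move=> bj; apply: commute_sym; rewrite /stair big_nat.
apply: commute_prod => i /andP[_ ib].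
by apply: commute_sym; apply: g_far; apply: leq_ltn_trans bj.
Qed.

Lemma stair_far a b j : (j.+1 < a)%N -> commute (stair a b) (g j).
Proof.
move=> ja; apply: commute_sym; rewrite /stair big_nat.
by apply: commute_prod => i /andP[ai _]; apply: g_far; exact: leq_trans ai.
Qed.

Lemma stair_row_far a b c d k : (b < c)%N ->
  commute (stair a b) (parity_row c d k).
Proof.
move=> bc; rewrite /parity_row big_nat_cond;
  apply: commute_prod => j /andP[/andP[cj _] _].
by apply: far_stair; exact: leq_trans cj.
Qed.

Lemma row_row_same a b c d k : commute (parity_row a b k) (parity_row c d k).
Proof.
apply: commute_prod => j /eqP jk; apply: commute_sym.
apply: commute_prod => i /eqP ik; have ij : odd i = odd j by rewrite ik.
case: (ltngtP i j) => [lt_ij | lt_ji | -> //].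
  apply: commute_sym; apply: g_far; rewrite ltn_neqAle lt_ij andbT.
  by apply/eqP=> ji; move: ij; rewrite -ji /=; case: odd.
apply: g_far; rewrite ltn_neqAle lt_ji andbT.
by apply/eqP=> ji; move: ij; rewrite -ji /=; case: odd.
Qed.

(** Conjugation by a staircase shifts the generators: move g_j to the left past
    the later factors, apply the braid relation once, and move on. *)
Lemma stair_shift a b j : (a <= j)%N -> (j.+1 < b)%N -> (b <= l)%N ->
  stair a b * g j = g j.+1 * stair a b.
Proof.
move=> aj jb bl.
have -> : stair a b = stair a j * (g j * g j.+1) * stair j.+2 b.
  rewrite /stair (big_cat_nat (n := j)) //=; last by rewrite ltnW // ltnW.
  rewrite (big_cat_nat (m := j) (n := j.+2)) ?leqW //=.
  by rewrite (big_ltn (m := j)) ?leqnSn // big_nat1 !mulgA.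
rewrite -mulgA (stair_far b (ltnSn _)) !mulgA; congr (_ * _).
rewrite -(far_stair a (ltnSn j)) -!mulgA; congr (_ * _).
by rewrite !mulgA g_near // (leq_trans jb).
Qed.

Lemma stair_row a b c k : (a <= c)%N -> (c < b)%N -> (b <= l)%N ->
  stair a b * parity_row a c k = parity_row a.+1 c.+1 k.+1 * stair a b.
Proof.
move=> + + bl; elim: c => [|c IHc] ac cb.
  by rewrite !row_nil ?mulg1 ?mul1g.
case: (ltngtP a c.+1) ac => // [ac _ | <- _];
  last by rewrite !row_nil ?mulg1 ?mul1g.
rewrite (row_cat (b := c)) // mulgA IHc ?(ltnW cb) // -mulgA row1.
rewrite (@row_cat _ c.+1 c.+2) // row1 /= (inj_eq negb_inj) -mulgA.
by congr (_ * _); case: eqP => _; rewrite ?mulg1 ?mul1g ?stair_shift.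
Qed.

Lemma alt_rowSr a b x k :
  alt (parity_row a b x) (parity_row a b x.+1) k.+1 =
  alt (parity_row a b x) (parity_row a b x.+1) k * parity_row a b (x + k).
Proof.
rewrite altSr; congr (_ * _); case: ifP => ok; apply: row_odd;
  rewrite /= oddD ok.
  by rewrite addbT.
by rewrite addbF.
Qed.

Lemma row_skip a b k : odd a != odd k -> parity_row a b k = parity_row a.+1 b k.
Proof.
move=> ak; case: (ltnP a b) => ab; last by rewrite !row_nil // leqW.
by rewrite (row_cat (b := a.+1)) // row1 (negbTE ak) mul1g.
Qed.

(** The first strand of the brick wall crosses one further strand in each row.
    Pulling this strand past the other rows shifts the bricks on its left by
    one step, so that they complete the bricks on its right to a brick wall on
    the remaining strands. *)
Lemma alt_rows_sweep a b k : (a + k < b)%N -> (b <= l)%N ->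
  alt (parity_row a b a) (parity_row a b a.+1) k.+1 =
  alt (parity_row a.+1 b a) (parity_row a.+1 b a.+1) k
    * parity_row (a + k).+1 b (a + k) * stair a (a + k).+1.
Proof.
have oS c : odd c.+1 != odd c by rewrite /=; case: odd.
move=> + bl; elim: k => [|k IHk].
  rewrite addn0 => ab; rewrite /= mul1g mulg1 (row_cat (b := a.+1)) // row1
    eqxx.
  have -> : stair a a.+1 = g a by rewrite /stair big_nat1.
  have := stair_row_far a b a (ltnSn a.+1); rewrite -row_skip //.
  by rewrite /stair big_nat1.
rewrite addnS => akb; have aq := leq_addr k a.
rewrite alt_rowSr [in RHS]alt_rowSr addnS;
  move: (a + k)%N aq akb IHk => q aq qb IHk.
rewrite IHk ?(ltnW qb) //.
(* Split the new row at the brick that the first strand crosses. *)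
have -> : parity_row a b q.+1 =
  parity_row a q q.+1 * (g q.+1 * parity_row q.+2 b q.+1).
  rewrite (row_cat (b := q)) ?(ltnW (ltnW qb)) // (@row_skip q b) 1?eq_sym ?oS
    //.
  by rewrite (@row_cat q.+1 q.+2 b) // row1 eqxx.
have -> : parity_row a.+1 b q = parity_row q.+1 b q * parity_row a.+1 q.+1 q.
  by rewrite row_row_same -row_cat // ltnW.
have := stair_row q.+1 aq (ltnSn q) (leq_trans (ltnW qb) bl).
have q2 : odd q.+2 = odd q by rewrite /= negbK.
rewrite (row_odd _ _ q2) => swap.
rewrite -!mulgA; do 2![congr (_ * _)]; rewrite [LHS]mulgA swap -!mulgA.
congr (_ * _); rewrite mulgA -stairSr ?leqW //.
by rewrite row_skip ?oS //; apply: stair_row_far.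
Qed.

(** After all the rows the first strand has been removed from the brick wall,
    whichever colour the wall starts with; a wall that starts with the other
    colour has one more row before the strand starts to move. *)
Lemma alt_rows_peel a n (b := (a + n).+1) : (b <= l)%N ->
  let E := parity_row a b a in let O := parity_row a b a.+1 in
  let E' := parity_row a.+1 b a in let O' := parity_row a.+1 b a.+1 in
  alt E O n.+2 = alt E' O' n.+1 * stair a b /\
  alt O E n.+2 = alt O' E' n.+1 * stair a b.
Proof.
move=> bl E O E' O'; have an := leq_addr n a.
have OO' : O = O' by rewrite /O /O' -row_skip //=; case: odd.
have sweep : alt E O n.+1 = alt E' O' n * stair a b.
  by rewrite /E /O (alt_rows_sweep (ltnSn _) bl) (@row_nil b) // mulg1.
split; last by rewrite -[LHS]/(O * alt E O n.+1) sweep mulgA OO'.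
rewrite alt_rowSr sweep [in RHS]alt_rowSr addnS -/b -!mulgA; congr (_ * _).
rewrite (@row_cat a b.-1) ?leqnSn //= row1 /=.
have b2 : odd b.+1 = odd (a + n) by rewrite /= negbK.
case: eqP => [|_]; first by case: odd.
by rewrite mulg1 stair_row // -/b (row_odd _ _ b2).
Qed.

(** Both brick walls are the half-twist: removing the first strand leaves the
    same staircase and two brick walls on one strand less. *)
Theorem path_alt_comm a n : (a + n <= l)%N ->
  alt_comm n.+1 (parity_row a (a + n) a) (parity_row a (a + n) a.+1).
Proof.
elim: n a => [|n IHn] a; first by rewrite addn0 /alt_comm /= !row_nil.
rewrite addnS => anl; rewrite /alt_comm.
have [-> ->] := alt_rows_peel anl; congr (_ * _).
have /= := IHn a.+1 anl; rewrite addSn.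
have a2 : odd a.+2 = odd a by rewrite /= negbK.
by rewrite /alt_comm (row_odd _ _ a2) => /esym.
Qed.

End PathRelation.

(** * Signed powers and groups of bijections *)

Definition spow (G : groupType) (b : bool) n (x : G) :=
  if b then x ^+ n else x ^- n.

Section SignedPowers.
Variable G : groupType.
Implicit Types x y : G.

Lemma spow_morph (H : groupType) (f : G -> H) b n x :
  monoid_morphism f -> f (spow b n x) = spow b n (f x).
Proof.
case=> f1 fM; have fX k : f (x ^+ k) = f x ^+ k.
  by elim: k => // k IHk; rewrite !expgS fM IHk.
case: b => //=; rewrite -fX; apply: (mulgI (f (x ^+ n))).
by rewrite -fM !mulgV.
Qed.

Lemma spow_conj b n (x y : G) : spow b n (y * x * y^-1) = y * spow b n x * y^-1.
Proof.
have conjE z : y * z * y^-1 = z ^ y^-1 by rewrite conjgE invgK !mulgA.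
by rewrite !conjE; case: b => /=; rewrite -conjXg // conjVg.
Qed.

Lemma spow0 b x : spow b 0 x = 1.
Proof. by case: b; rewrite /spow expg0 ?invg1. Qed.

Lemma spow_closed b1 n1 b2 n2 x :
  exists b n, spow b1 n1 x * spow b2 n2 x = spow b n x.
Proof.
have mixed m n : exists b k, x ^+ m * x ^- n = spow b k x.
  case: (leqP n m) => [nm | /ltnW mn]; first by exists true, (m - n)%N;
    rewrite /= expgnFr.
  exists false, (n - m)%N; rewrite /= expgnFr // invgM invgK //.
case: b1 b2 => [] [] /=.
- by exists true, (n1 + n2)%N; rewrite /= expgnDr.
- exact: mixed.
- have [b [n E]] := mixed n2 n1; exists b, n; rewrite -E.
  exact/commute_sym/commuteV/commuteX2.
- by exists false, (n2 + n1)%N; rewrite /= expgnDr invgM.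
Qed.

Lemma commute_spow b b' m n x y :
  commute x y -> commute (spow b m x) (spow b' n y).
Proof.
move=> xy; have xyX : commute (x ^+ m) (y ^+ n) by exact: commuteX2.
have xVy : commute (x ^- m) (y ^+ n) by apply/commute_sym/commuteV/commute_sym.
by case: b b' => [] [] //=; exact: commuteV.
Qed.

Lemma spowMn b n x y : commute x y ->
  spow b n (x * y) = spow b n x * spow b n y.
Proof.
move=> xy; case: b; rewrite /spow expgMn // invgM.
exact: (commute_spow false false n n (commute_sym xy)).
Qed.

Lemma spow_prod (I : Type) (r : seq I) (F : I -> G) b n :
    (forall i j, commute (F i) (F j)) ->
  spow b n (\prod_(i <- r) F i) = \prod_(i <- r) spow b n (F i).
Proof.
move=> FF; elim: r => [|i r IHr].
  by rewrite !big_nil; case: b; rewrite /spow expg1n ?invg1.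
by rewrite !big_cons spowMn ?IHr //; exact: commute_prod.
Qed.

Lemma spowX b m n x : spow b n (x ^+ m) = spow b (m * n) x.
Proof. by case: b; rewrite /spow expgnA. Qed.

(** In a group of maps this lets a chosen factor act first. *)
Lemma prod_to_end (I : eqType) (r : seq I) (F : I -> G) i :
    (forall i j, commute (F i) (F j)) -> uniq r -> i \in r ->
  exists2 r', i \notin r' & \prod_(j <- r) F j = \prod_(j <- r') F j * F i.
Proof.
move=> FF + ir; case/splitPr: ir => r1 r2;
  rewrite cat_uniq /= => /and4P[_ r1r2 ir2 _].
exists (r1 ++ r2).
  by rewrite mem_cat negb_or ir2 andbT; apply: contra r1r2 => ->.
rewrite !big_cat big_cons -mulgA; congr (_ * _).
exact: commute_prod.
Qed.

End SignedPowers.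

Lemma comp_morph (G H K : groupType) (f : H -> K) (g : G -> H) :
  monoid_morphism f -> monoid_morphism g -> monoid_morphism (f \o g).
Proof.
by move=> [f1 fM] [g1 gM]; split=> [|x y] /=; rewrite ?g1 ?f1 // gM fM.
Qed.

Record bij (X : Type) := Bij {
  bij_fun :> X -> X;
  bij_inv : X -> X;
  bij_funK : cancel bij_fun bij_inv;
  bij_invK : cancel bij_inv bij_fun
}.

Section BijGroup.
Variable X : Type.
Implicit Types f g h : bij X.

Lemma bij_ext f g : f =1 g -> f = g.
Proof.
case: f g => f f' fK f'K [g g' gK g'K] /= /funext fg.
rewrite {f}fg in fK f'K *.
have : f' = g' by apply/funext=> x; rewrite -{1}(g'K x) fK.
move=> f'g'; rewrite {f'}f'g' in fK f'K *.
by rewrite (Prop_irrelevance fK gK) (Prop_irrelevance f'K g'K).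
Qed.

Definition bij_one := @Bij X id id (fun=> erefl) (fun=> erefl).
Definition bij_mul f g :=
  Bij (can_comp (bij_funK f) (bij_funK g)) (can_comp (bij_invK g) (bij_invK f)).
Definition bij_V f := Bij (bij_invK f) (bij_funK f).

HB.instance Definition _ := gen_eqMixin (bij X).
HB.instance Definition _ := gen_choiceMixin (bij X).

Lemma bij_mulA : associative bij_mul. Proof. by move=> *; exact: bij_ext. Qed.
Lemma bij_mul1g : left_id bij_one bij_mul. Proof. by move=> *;
  exact: bij_ext. Qed.
Lemma bij_mulg1 : right_id bij_one bij_mul. Proof. by move=> *;
  exact: bij_ext. Qed.
Lemma bij_mulVg : left_inverse bij_one bij_V bij_mul.
Proof. by move=> f; apply: bij_ext => x; exact: bij_funK. Qed.
Lemma bij_mulgV : right_inverse bij_one bij_V bij_mul.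
Proof. by move=> f; apply: bij_ext => x; exact: bij_invK. Qed.

HB.instance Definition _ := isGroup.Build (bij X)
  bij_mulA bij_mul1g bij_mulg1 bij_mulVg bij_mulgV.

Lemma bij_mulE f g x : (f * g) x = f (g x). Proof. by []. Qed.
Lemma bij_VE f x : (f^-1) x = bij_inv f x. Proof. by []. Qed.

End BijGroup.

(** * Ping-pong for right-angled Artin groups *)

(** Elements are measured by their number of syllables, powers of a single
    generator. This replaces normal forms in right-angled Artin groups: all
    that ping-pong needs is that a word of minimal length cannot be shortened
    by merging syllables. *)
Section PingPong.
Variables (G : groupType) (S : eqType) (gen : S -> G) (comm : rel S).
Hypothesis comm_sym : symmetric comm.
Hypothesis comm_gen : forall s t, comm s t -> commute (gen s) (gen t).
Variables (X : Type) (act : G -> X -> X).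
Hypothesis actM : forall g h x, act (g * h) x = act g (act h x).
Variables (base : S -> X) (dom : S -> X -> Prop).
Hypothesis dom_enter : forall s t b n x, s != t -> ~~ comm s t -> (0 < n)%N ->
  dom t x -> dom s (act (spow b n (gen s)) x).
Hypothesis dom_keep : forall s t b n x, s != t -> comm s t ->
  dom t x -> dom t (act (spow b n (gen s)) x).
Hypothesis dom_base : forall s b n, (0 < n)%N ->
  dom s (act (spow b n (gen s)) (base s)).
Hypothesis base_notin : forall s t, ~ dom s (base t).

Fixpoint syllables n g := if n is n'.+1 then
  exists s b k h, g = spow b k (gen s) * h /\ syllables n' h else g = 1.

Lemma syllables_cons s b k n h :
  syllables n h -> syllables n.+1 (spow b k (gen s) * h).
Proof. by exists s, b, k, h. Qed.

(** The first syllable of a minimal product decides where the image lies. If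
    the second syllable does not commute with the first, the induction
    hypothesis and [dom_enter] apply. If it commutes, exchange the two: the
    product without the second syllable is again minimal and starts with the
    first, and the second syllable then preserves the domain of the first. *)
Lemma minimal_dom n s b k h : syllables n h ->
    (forall m, (m <= n)%N -> ~ syllables m (spow b k (gen s) * h)) ->
  exists r, dom s (act (spow b k (gen s) * h) (base r)).
Proof.
elim: n => [|n IHn] in s b k h *.
  move=> -> min; exists s; rewrite mulg1; apply: dom_base; rewrite lt0n.
  by apply/negP=> /eqP k0; apply: (min 0%N); rewrite //= k0 spow0 mulg1.
case=> t [b' [k' [h' [-> sh']]]] min.
have k_gt0 : (0 < k)%N.
  rewrite lt0n; apply/negP=> /eqP k0; apply: (min n.+1) => //.
  by rewrite k0 spow0 mul1g; exact: syllables_cons.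
have neq_st : s != t.
  apply/eqP=> st; rewrite -{}st in min.
  apply: (min n.+1) => //; rewrite mulgA.
  by have [b2 [k2 ->]] := spow_closed b k b' k' (gen s); exact: syllables_cons.
case st : (comm s t); last first.
  have [m mn sm | r rt] := IHn t b' k' h' sh'.
    by apply: (min m.+1) => //; exact: syllables_cons.
  by exists r; rewrite actM; apply: dom_enter rt; rewrite ?st.
have swap : spow b k (gen s) * (spow b' k' (gen t) * h') =
            spow b' k' (gen t) * (spow b k (gen s) * h').
  by rewrite !mulgA (commute_spow b b' k k' (comm_gen st)).
have [m mn sm | r rs] := IHn s b k h' sh'.
  by apply: (min m.+1) => //; rewrite swap; exact: syllables_cons.
exists r; rewrite swap actM; apply: dom_keep rs; first by rewrite eq_sym.
by rewrite comm_sym.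
Qed.

Theorem ping_pong n g : syllables n g -> (forall x, act g x = x) -> g = 1.
Proof.
move=> sg triv; have ex : exists m, `[< syllables m g >] by exists n;
  exact/asboolP.
case: (ex_minnP ex) => -[|m] /asboolP //= [s [b [k [h [gE sh]]]]] min.
have [j jm | r] := @minimal_dom m s b k h sh.
  by rewrite -gE => sj; have := min j (asboolT sj); rewrite ltnNge jm.
by rewrite -gE triv => /base_notin.
Qed.

End PingPong.

(** * Reduced words in a free group *)

Section FreeGroup.
Variable L : choiceType.
Implicit Types (a b c : L * bool) (u v w : word L).

Definition no_rel u v := False.
Definition free_group : Type := presented_group no_rel.
HB.instance Definition _ := Group.on free_group.
Definition fclass : word L -> free_group := @pres_class L no_rel.

Lemma fclass_cat u v : fclass (u ++ v) = fclass u * fclass v.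
Proof. exact: pres_classM. Qed.

Lemma fclass_nil : fclass [::] = 1.
Proof. by []. Qed.

Lemma fclass_cons a u : fclass (a :: u) = fclass [:: a] * fclass u.
Proof. exact: fclass_cat [:: a] u. Qed.

Lemma fclass_inv u : fclass (word_inv u) = (fclass u)^-1.
Proof. by symmetry; exact: pres_invE. Qed.

Definition flip a := (a.1, ~~ a.2).

Lemma flipK : involutive flip.
Proof. by case=> s b; rewrite /flip negbK. Qed.

Definition reduced w := sorted (fun a b => b != flip a) w.

Definition push a w :=
  if w is b :: w' then if b == flip a then w' else a :: w else [:: a].

Definition nf w := foldr push [::] w.

Lemma reduced_behead a w : reduced (a :: w) -> reduced w.
Proof. exact: path_sorted. Qed.

Lemma reduced_push a w : reduced w -> reduced (push a w).
Proof.
case: w => //= b w; case: ifP => [_ | ba] bw; first exact: path_sorted bw.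
by rewrite /reduced /= ba.
Qed.

Lemma push_reduced a w : reduced (a :: w) -> push a w = a :: w.
Proof. by case: w => //= b w /andP[/negbTE->]. Qed.

Lemma reduced_foldr u w : reduced w -> reduced (foldr push w u).
Proof. by move=> rw; elim: u => //= a u; apply: reduced_push. Qed.

Lemma reduced_nf u : reduced (nf u).
Proof. exact: reduced_foldr. Qed.

(** Letters thus act on reduced words by bijections that respect cancellation,
    which makes the normal form an invariant of the group element. *)
Lemma push_flipK a w : reduced w -> push a (push (flip a) w) = w.
Proof.
case: w => [|b w]; first by rewrite /= eqxx.
rewrite [push (flip a) _]/= flipK; case: eqP => [-> | _];
  first exact: push_reduced.
by rewrite /= eqxx.
Qed.

Lemma foldr_push_pres u v w :
  pres_eq no_rel u v -> reduced w -> foldr push w u = foldr push w v.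
Proof.
move=> uv; elim: uv w => {u v} //.
- by move=> u v _ IH w /IH.
- by move=> u v x _ IH1 _ IH2 w rw; rewrite IH1 ?IH2.
- move=> u u' v v' _ IHu _ IHv w rw; rewrite !foldr_cat IHv // IHu //.
  exact: reduced_foldr.
- by move=> s b w rw; exact: push_flipK (s, b) w rw.
Qed.

Lemma fclassP u v : fclass u = fclass v -> nf u = nf v.
Proof. by move/pres_classP => uv; exact: foldr_push_pres. Qed.

Lemma nf_id w : reduced w -> nf w = w.
Proof.
elim: w => //= a w IHw raw; rewrite IHw ?push_reduced //.
exact: reduced_behead raw.
Qed.

Lemma fclass_nf w : fclass (nf w) = fclass w.
Proof.
elim: w => //= a w IHw; transitivity (fclass (a :: nf w)); last first.
  by rewrite fclass_cons IHw -fclass_cons.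
case: (nf w) => //= b v; case: eqP => // ->.
rewrite (fclass_cat [:: a; flip a]) -[LHS]mul1g; congr (_ * _).
symmetry; apply/pres_classP; case: a => s c; exact: pres_cancel.
Qed.

Lemma reduced_fclassP u w : reduced w -> fclass u = fclass w -> nf u = w.
Proof. by move=> rw uw; rewrite (fclassP uw) nf_id. Qed.

Lemma nf_nil w : nf w = [::] -> fclass w = 1.
Proof. by move=> w0; rewrite -fclass_nf w0. Qed.

Lemma all_nf (P : pred (L * bool)) w : all P w -> all P (nf w).
Proof.
elim: w => //= a w IHw /andP[Pa /IHw{IHw}]; case: (nf w) => [|b v] /=.
  by rewrite Pa.
by move=> /andP[Pb Pv]; case: eqP => _ //=; rewrite Pa Pb.
Qed.

Lemma word_inv_cat u v : word_inv (u ++ v) = word_inv v ++ word_inv u.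
Proof. by rewrite /word_inv map_cat rev_cat. Qed.

Lemma reduced_inv w : reduced w -> reduced (word_inv w).
Proof.
rewrite /reduced /word_inv rev_sorted sorted_map;
  apply: sub_sorted => -[s b] [t c] /=.
by rewrite /flip /= negbK !xpair_eqE eq_sym [c == _]eq_sym.
Qed.

Lemma nf_inv w : nf (word_inv w) = word_inv (nf w).
Proof.
apply: reduced_fclassP; first exact/reduced_inv/reduced_nf.
by rewrite !fclass_inv fclass_nf.
Qed.

Lemma reduced_cat u a w :
  reduced (u ++ [:: a]) -> reduced (a :: w) -> reduced (u ++ a :: w).
Proof.
case: u => // b u; rewrite /reduced /= !cat_path /= => /andP[-> /andP[-> _]].
by [].
Qed.

Lemma reduced_suffix u w : reduced (u ++ w) -> reduced w.
Proof. by elim: u => //= a u IHu /reduced_behead. Qed.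

Lemma reduced_prefix u w : reduced (u ++ w) -> reduced u.
Proof. by case: u => // a u; rewrite /reduced /= cat_path => /andP[]. Qed.

Definition fword (x : free_group) : word L := nf (pres_repr x).

Lemma reduced_fword x : reduced (fword x). Proof. exact: reduced_nf. Qed.

Lemma fclass_fword x : fclass (fword x) = x.
Proof. by rewrite fclass_nf; exact: pres_reprK. Qed.

Lemma fword_fclass w : fword (fclass w) = nf w.
Proof. by apply: fclassP; exact: pres_reprK. Qed.

(** * Inserting words at prescribed letters *)

(** The endomorphism that multiplies each letter s on the left by the word
    [p s]. The words [p s] only use owned letters, and owned letters are fixed,
    so that a reduced word is changed only inside its maximal runs of owned
    letters. *)
Section Substitution.
Variables (owned : pred L) (p : L -> word L).
Hypothesis p_owned : forall s, owned s -> p s = [::].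
Hypothesis owned_p : forall s, all (fun a => owned a.1) (p s).

Definition left_part a := if a.2 then p a.1 else [::].
Definition right_part a := if a.2 then [::] else word_inv (p a.1).
Definition insert_letter a := left_part a ++ a :: right_part a.
Definition insert w := flatten (map insert_letter w).

Lemma insert_cat u v : insert (u ++ v) = insert u ++ insert v.
Proof. by rewrite /insert map_cat flatten_cat. Qed.

Lemma insert_inv w : insert (word_inv w) = word_inv (insert w).
Proof.
elim: w => // a w IHw; rewrite -[a :: w]/([:: a] ++ w) word_inv_cat !insert_cat
  IHw word_inv_cat.
congr (_ ++ _); rewrite /insert /= !cats0 /insert_letter.
case: a => s [] /=; rewrite /left_part /right_part /= ?word_inv_cat ?cats0 //.
by rewrite -[(s, false) :: _]/([:: (s, false)] ++ _) word_inv_cat word_invK.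
Qed.

Let own a := owned a.1.

Lemma own_left a : all own (left_part a).
Proof. by rewrite /left_part; case: a.2. Qed.

Lemma own_right a : all own (right_part a).
Proof.
rewrite /right_part; case: a.2 => //; rewrite /word_inv all_rev all_map.
exact: owned_p.
Qed.

Lemma insert_own r : all own r -> insert r = r.
Proof.
elim: r => //= a r IHr /andP[oa /IHr]; rewrite /insert /= => ->.
by rewrite /insert_letter /left_part /right_part p_owned //; case: a.2.
Qed.

Lemma reduced_own_cat m b z :
  all own m -> ~~ own b -> reduced m -> reduced (b :: z) ->
    reduced (m ++ b :: z).
Proof.
move=> + ob; case/lastP: m => // m a; rewrite all_rcons => /andP[oa _] + rbz.
rewrite -cats1 -catA => /reduced_cat; apply; apply/andP; split=> //.
by apply: contraNneq ob => ->.
Qed.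

(** After the change, a run r between two foreign letters a and b may become
    empty, but a and b still do not cancel: if b were the inverse of a, the new
    run would be a conjugate of r, so r would have been empty as well. *)
Lemma reduced_gap a r b w z :
    ~~ own a -> ~~ own b -> all own r ->
    reduced (a :: r ++ b :: w) -> reduced (b :: z) ->
  reduced (a :: nf (right_part a ++ r ++ left_part b) ++ b :: z).
Proof.
move=> oa ob or rarb rbz; set m := nf _.
have om : all own m by apply: all_nf; rewrite !all_cat own_right or own_left.
have rm : reduced (m ++ b :: z) by apply: reduced_own_cat => //;
  exact: reduced_nf.
suffices am : ~ (m = [::] /\ b = flip a).
  case: m om rm am => [|c m] om rm am; rewrite /reduced /= in om rm *;
    rewrite rm andbT.
    by apply: contra_notN am => /eqP.
  by case/andP: om => oc _; apply: contraNneq oa => ca; move: oc; rewrite ca.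
case=> /nf_nil + ba; rewrite !fclass_cat => m1.
have : fclass r = 1.
  move: m1; rewrite ba /left_part /right_part /=; case: (a.2) => /=.
    by rewrite fclass_nil mul1g mulg1.
  rewrite fclass_inv => /eqP; rewrite -conjgE => m1; apply/eqP.
  by rewrite -(conjg_eq1 _ (fclass (p a.1))).
move/(@fclassP r [::]); rewrite nf_id.
  by move=> r0; move: rarb; rewrite r0 ba /reduced /= eqxx.
exact: reduced_prefix (reduced_behead rarb).
Qed.

Lemma split_own w : exists r v,
  [/\ w = r ++ v, all own r & if v is c :: _ then ~~ own c else true].
Proof.
elim: w => [|a w [r [v [-> or ov]]]]; first by exists [::], [::].
case oa: (own a); first by exists (a :: r), v; rewrite /= oa.
by exists [::], (a :: r ++ v); rewrite /= oa.
Qed.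

Lemma insert_cons a w :
  insert (a :: w) = left_part a ++ a :: right_part a ++ insert w.
Proof. by rewrite /insert /= -catA. Qed.

Lemma nf_insert_head b w : ~~ own b -> reduced (b :: w) ->
  exists z, nf (b :: right_part b ++ insert w) = b :: z.
Proof.
have [n] := ubnP (size w); elim: n => // n IHn in b w *.
rewrite ltnS => + ob; have [r [v [-> or]]] := split_own w.
rewrite insert_cat insert_own //; case: v => [_ _ rbr | c v oc sz rbrcv].
  suffices rbr' : reduced (b :: nf (right_part b ++ r)).
    by exists (nf (right_part b ++ r)); rewrite cats0;
      exact: (push_reduced rbr').
  have := reduced_nf (right_part b ++ r).
  have : all own (nf (right_part b ++ r))
    by rewrite all_nf // all_cat own_right.
  case: nf => // c m /= /andP[oc _]; rewrite /reduced /= => ->; rewrite andbT.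
  by apply: contraNneq ob => cb; move: oc; rewrite cb.
have [||z cz] := IHn c v _ oc.
- by apply: leq_trans sz; rewrite size_cat /= addnS ltnS leq_addl.
- exact: reduced_suffix (reduced_behead rbrcv).
have rcz : reduced (c :: z) by rewrite -cz; exact: reduced_nf.
exists (nf (right_part b ++ r ++ left_part c) ++ c :: z).
apply: reduced_fclassP; first exact: reduced_gap rbrcv rcz.
rewrite insert_cons fclass_cons [RHS]fclass_cons !fclass_cat fclass_nf -cz
  fclass_nf.
by rewrite !fclass_cat !mulgA.
Qed.

(** The mirror image of the previous lemma, obtained by passing to inverses. *)
Lemma nf_insert_last a w : ~~ own a -> reduced (w ++ [:: a]) ->
  exists z, nf (insert w ++ left_part a ++ [:: a]) = z ++ [:: a].
Proof.
move=> oa /reduced_inv; rewrite word_inv_cat => rw.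
have [//||z fz] := @nf_insert_head (flip a) (word_inv w).
  by move: rw; rewrite /word_inv.
exists (word_inv z); rewrite -[LHS]word_invK -nf_inv !word_inv_cat.
have -> : word_inv (left_part a) = right_part (flip a).
  by rewrite /left_part /right_part /=; case: a.2.
rewrite -insert_inv -catA (_ : word_inv [:: a] = [:: flip a]) // cat1s fz.
by rewrite (word_inv_cat [:: flip a]) -[[:: flip a]]/(word_inv [:: a])
  word_invK.
Qed.

(** Only the owned letters between two consecutive foreign letters are
    affected, so a change seen at one place of a reduced word is never undone
    by cancellation elsewhere. *)
Theorem nf_insert_gap u a b w : ~~ own a -> ~~ own b ->
    reduced (u ++ a :: b :: w) ->
  exists u' w', nf (insert (u ++ a :: b :: w)) =
    u' ++ a :: nf (right_part a ++ left_part b) ++ b :: w'.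
Proof.
move=> oa ob ruabw; have rabw := reduced_suffix ruabw.
have [|u' fu] := @nf_insert_last a u oa.
  by apply: (@reduced_prefix _ (b :: w)); rewrite -catA.
have [|w' fw] := @nf_insert_head b w ob; first exact: reduced_behead rabw.
exists u', w'; apply: reduced_fclassP.
  apply: reduced_cat; first by rewrite -fu; exact: reduced_nf.
  have := @reduced_gap a [::] b w w' oa ob isT rabw; apply.
  by rewrite -fw; exact: reduced_nf.
rewrite insert_cat !insert_cons -[u' ++ _]cat_rcons -cats1 -fu -fw.
rewrite [RHS]fclass_cat [in RHS]fclass_cat !fclass_nf -!fclass_cat.
by rewrite -!catA.
Qed.

End Substitution.
End FreeGroup.

(** * Twists along the circles of a bipartite graph *)

Lemma free_morph_ext (L : choiceType) (G : groupType)
    (f g : free_group L -> G) :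
    monoid_morphism f -> monoid_morphism g ->
    (forall l, f (fclass [:: (l, true)]) = g (fclass [:: (l, true)])) ->
  f =1 g.
Proof.
move=> [f1 fM] [g1 gM] fg x; rewrite -(fclass_fword x).
elim: (fword x) => [|[l b] w IHw]; first by rewrite f1 g1.
rewrite fclass_cons fM gM IHw; congr (_ * _); case: b => //.
have cV : fclass [:: (l, true)] * fclass [:: (l, false)] = 1.
  by rewrite -fclass_cat; apply/pres_classP/pres_cancel.
by apply: (mulgI (f (fclass [:: (l, true)]))); rewrite -fM fg -gM cV f1 g1.
Qed.

(** The letter (v, w) is the arc of the circle of v that starts at the position
    of w. All the vertices have a position on each circle, in the cyclic order
    of the list e, but only the neighbours of v give rise to crossings. *)
Section Twists.
Variables (V : choiceType) (e : seq V) (adj : rel V) (side : pred V).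
Hypothesis e_uniq : uniq e.
Hypothesis adj_e : forall u v, adj u v -> u \in e.
Hypothesis adj_sym : symmetric adj.
Hypothesis adj_side : forall u v, adj u v -> side v = ~~ side u.

Notation L := (V * V)%type.
Notation F := (free_group L).
Notation letter l := (fclass [:: (l, true)]).

Lemma adj_irr v : adj v v = false.
Proof. by apply/negP=> /adj_side; case: (side v). Qed.

Definition cyclic_from (u : V) := drop (index u e) e ++ take (index u e) e.

(** One full turn around the circle of v, from the position of u. *)
Definition circle v u : word L := [seq ((v, w), true) | w <- cyclic_from u].

Definition wpow (b : bool) n (w : word L) :=
  let wn := flatten (nseq n w) in if b then wn else word_inv wn.

Lemma fclass_wpow b n w : fclass (wpow b n w) = spow b n (fclass w).
Proof.
have wnE : fclass (flatten (nseq n w)) = fclass w ^+ n.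
  by elim: n => //= n IHn; rewrite fclass_cat IHn -expgS.
by case: b => //=; rewrite fclass_inv wnE.
Qed.

Definition twist_pre v b n (l : L) : word L :=
  if (l.2 == v) && adj l.1 v then wpow b n (circle v l.1) else [::].

Definition twist_gen v b n (l : L) : F := fclass (twist_pre v b n l) * letter l.

Lemma twist_gen_rel v b n : respects_rel (@no_rel L) (twist_gen v b n).
Proof. by []. Qed.

Definition twist v b n : F -> F := pres_lift (twist_gen_rel v b n).

Lemma twist_morph v b n : monoid_morphism (twist v b n).
Proof. exact: pres_lift_monoid_morphism. Qed.

Lemma twistM v b n x y : twist v b n (x * y) = twist v b n x * twist v b n y.
Proof. by case: (twist_morph v b n) => _ ->. Qed.

Lemma twist_letter v b n l : twist v b n (letter l) =
  if (l.2 == v) && adj l.1 v then spow b n (fclass (circle v l.1)) * letter l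
    else letter l.
Proof.
rewrite [LHS]pres_lift_gen /twist_gen /twist_pre; case: ifP => _.
  by rewrite fclass_wpow.
by rewrite fclass_nil mul1g.
Qed.

Definition own_word u (w : seq V) : F := fclass [seq ((u, w'), true) | w' <- w].

Lemma twist_fix v b n u w : (adj u v -> v \notin w) ->
  twist v b n (own_word u w) = own_word u w.
Proof.
elim: w => [|w' w IHw] uw; first by case: (twist_morph v b n).
rewrite /own_word /= fclass_cons twistM -/(own_word u w) IHw => [|/uw];
  last first.
  by rewrite inE negb_or => /andP[].
rewrite twist_letter /=; case: ifP => // /andP[/eqP w'v /uw].
by rewrite w'v mem_head.
Qed.

Lemma twist_circle_self v b n u :
  twist v b n (fclass (circle v u)) = fclass (circle v u).
Proof. by apply: twist_fix; rewrite adj_irr. Qed.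

Lemma cyclic_from_uniq u : uniq (cyclic_from u).
Proof. by rewrite /cyclic_from uniq_catC cat_take_drop. Qed.

Lemma cyclic_from_head u : u \in e ->
  exists2 w, cyclic_from u = u :: w & u \notin w.
Proof.
move=> ue; have := cyclic_from_uniq u;
  rewrite /cyclic_from (drop_nth u) ?index_mem // nth_index //.
by move=> /= /andP[]; exists (drop (index u e).+1 e ++ take (index u e) e).
Qed.

(** Starting a turn at another position conjugates it. The conjugating path m
    can be chosen to avoid the arc of u, by going from u' to u in the direction
    that the turn takes; then the twists along u and v both fix it. *)
Lemma cyclic_from_conj u u' : u \in e ->
  exists2 m, u \notin m & cyclic_from u' ++ m = m ++ cyclic_from u.
Proof.
move=> ue; rewrite /cyclic_from; set i := index u e; set i' := index u' e.
have ui : u \notin take i e.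
  by apply/negP=> /index_ltn; rewrite ltnn.
case: (leqP i' i) => [i'i | ii'].
  exists (drop i' (take i e)).
    by apply: contra ui; exact: mem_drop.
  have -> : drop i' e = drop i' (take i e) ++ drop i e.
    rewrite -{1}(cat_take_drop i e) drop_cat size_takel ?index_size //.
    case: ltngtP i'i => // [-> _];
      rewrite subnn drop0 (@drop_oversize _ _ (take _ _)) //.
    by rewrite size_takel ?index_size.
  by rewrite -!catA -{1}(@take_takel _ i' i) // cat_take_drop.
exists (drop i' e ++ take i e).
  rewrite mem_cat negb_or ui andbT; apply/negP=> ui'.
  have := e_uniq; rewrite -(cat_take_drop i' e) cat_uniq => /and3P[_ /hasPn/(_
    _ ui')].
  by rewrite /= in_take_leq ?index_size // ii'.
by rewrite -!catA; congr (_ ++ _); rewrite !catA !cat_take_drop.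
Qed.

Lemma twist_neighbour_circle u v n b : adj u v ->
  twist u b n (fclass (circle v u)) =
    spow b n (fclass (circle u v)) * fclass (circle v u).
Proof.
move=> uv; have [w cw uw] := cyclic_from_head (adj_e uv).
rewrite /circle -/(circle u v) cw /= fclass_cons twistM -/(own_word v w).
rewrite twist_fix // twist_letter /= eqxx adj_sym uv /= mulgA.
by [].
Qed.

Lemma twistX v b m n x : twist v b m (twist v b n x) = twist v b (m + n) x.
Proof.
move: x; apply: free_morph_ext => [||l].
- by apply: comp_morph; exact: twist_morph.
- exact: twist_morph.
rewrite /= !twist_letter; case lv: (_ && _); last by rewrite twist_letter lv.
rewrite twistM (spow_morph _ _ _ (twist_morph _ _ _)) twist_circle_self
  twist_letter lv.
rewrite mulgA; congr (_ * _); case: b; rewrite /spow;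
  first by rewrite addnC expgnDr.
by rewrite expgnDr invgM.
Qed.

Lemma twist0 v b x : twist v b 0 x = x.
Proof.
move: x; apply: free_morph_ext => [||l]; [exact: twist_morph | by [] |].
by rewrite twist_letter; case: ifP => // _; case: b;
  rewrite /spow expg0 ?invg1 mul1g.
Qed.

Lemma twistK v b n : cancel (twist v b n) (twist v (~~ b) n).
Proof.
move=> x; move: x; apply: free_morph_ext => [||l]; last 1 first.
- rewrite /= twist_letter; case lv: (_ && _); last by rewrite twist_letter lv.
  rewrite twistM (spow_morph _ _ _ (twist_morph _ _ _)) twist_circle_self
    twist_letter lv.
  by rewrite mulgA -[RHS]mul1g; congr (_ * _); case: b;
    rewrite /spow ?mulgV ?mulVg.
- by apply: comp_morph; exact: twist_morph.
- by [].
Qed.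

Lemma twist_commute u v b b' m n x : u != v -> adj u v = false ->
  twist u b m (twist v b' n x) = twist v b' n (twist u b m x).
Proof.
move=> uv Auv; move: x; apply: free_morph_ext => [||l]; last 1 first.
- wlog lu : u v b b' m n uv Auv / l.2 != u => [th|].
    case lu: (l.2 == u); last by apply: th => //; rewrite lu.
    symmetry; apply: th; first by rewrite eq_sym.
      by rewrite adj_sym.
    by rewrite (eqP lu).
  rewrite /= (twist_letter u) (negbTE lu) /= !twist_letter; case lv: (_ && _);
    last first.
    by rewrite twist_letter (negbTE lu).
  rewrite twistM (spow_morph _ _ _ (twist_morph _ _ _)) twist_letter (negbTE
    lu) /=.
  by rewrite twist_fix // adj_sym Auv.
- by apply: comp_morph; exact: twist_morph.
- by apply: comp_morph; exact: twist_morph.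
Qed.

Lemma twistVK v b n : cancel (twist v (~~ b) n) (twist v b n).
Proof. by move=> x; rewrite -{1}(negbK b) twistK. Qed.

(** The two colour classes twist in opposite directions; with equal directions
    the braid relation would fail. *)
Definition twist_bij v : bij F :=
  Bij (twistK v (side v) 1) (twistVK v (side v) 1).

Lemma twist_bijE v x : twist_bij v x = twist v (side v) 1 x. Proof. by []. Qed.

Lemma twist_bijX v n x : (twist_bij v ^+ n) x = twist v (side v) n x.
Proof.
elim: n x => [|n IHn] x; first by rewrite twist0.
by rewrite expgS bij_mulE IHn twist_bijE twistX.
Qed.

Lemma twist_bijVX v n x : (twist_bij v ^- n) x = twist v (~~ side v) n x.
Proof.
rewrite bij_VE; apply: (can_inj (bij_funK (twist_bij v ^+ n))).
by rewrite bij_invK twist_bijX -{1}(negbK (side v)) twistK.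
Qed.

Lemma twist_bij_commute u v : adj u v = false ->
  commute (twist_bij u) (twist_bij v).
Proof.
move=> uv; case: (eqVneq u v) => [-> //|neq_uv].
by apply: bij_ext => x; rewrite !bij_mulE !twist_bijE twist_commute.
Qed.

(** Write A and B for the turns around v and u from their common crossing. The
    twists send A to B^-1 A and B to A B, or A to B A and B to A^-1 B,
    according to the colours, and the turn around v from the position of w is
    conjugate to A by a path fixed by both twists. What remains is an identity
    between words in A and B. *)
Lemma twist_braid_letter u v w : adj u v ->
  twist v (side v) 1 (twist u (side u) 1 (twist v (side v) 1 (letter (w, v)))) =
  twist u (side u) 1 (twist v (side v) 1 (twist u (side u) 1 (letter (w, v)))).
Proof.
move=> uv; have neq_vu : (v == u) = false.
  by apply: contraTF uv => /eqP->; rewrite adj_irr.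
have cu : twist u (side u) 1 (letter (w, v)) = letter (w, v).
  by rewrite twist_letter /= neq_vu.
case wv: (adj w v); last first.
  by rewrite cu twist_letter /= wv andbF cu twist_letter /= wv andbF.
have [m um wm] := cyclic_from_conj w (adj_e uv).
pose P := own_word v m; pose A := fclass (circle v u);
  pose B := fclass (circle u v).
have Pv : twist v (side v) 1 P = P by rewrite twist_fix ?adj_irr.
have Pu : twist u (side u) 1 P = P by exact: twist_fix.
have PE : fclass (circle v w) = P * A * P^-1.
  apply: (mulIg P); rewrite mulgVK /P /A /own_word /circle -!fclass_cat
    -!map_cat.
  by rewrite wm.
have Av : twist v (side v) 1 A = A by exact: twist_circle_self.
have Au : twist u (side u) 1 A = spow (side u) 1 B * A.
  exact: twist_neighbour_circle.
have Bv : twist v (side v) 1 B = spow (side v) 1 A * B.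
  by apply: twist_neighbour_circle; rewrite adj_sym.
have sp x y b n z : twist x y 1 (spow b n z) = spow b n (twist x y 1 z).
  exact: spow_morph (twist_morph _ _ _).
have tV x y z : twist x y 1 z^-1 = (twist x y 1 z)^-1.
  exact: (sp x y false 1%N).
rewrite cu twist_letter /= eqxx wv /= PE spow_conj.
rewrite !twistM !(Pv, Pu, Av, Au, Bv, tV, sp, cu).
rewrite twistM !(Pv, Pu, Av, Au, Bv, tV, sp, cu).
rewrite twist_letter /= eqxx wv PE spow_conj /= !mulgA mulgVK;
  do 2![congr (_ * _)].
rewrite -!mulgA; congr (_ * _); rewrite (adj_side uv); case: (side u);
  rewrite /spow !expg1.
  by rewrite !invgM !invgK !mulgA mulgK.
by rewrite !invgM !mulgA mulgVK.
Qed.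

Lemma twist_bij_braid u v : adj u v ->
  twist_bij u * twist_bij v * twist_bij u =
  twist_bij v * twist_bij u * twist_bij v.
Proof.
move=> uv; apply: bij_ext => x; rewrite !bij_mulE !twist_bijE; move: x.
apply: free_morph_ext => [||l]; last 1 first.
- case: l => w x; case lv: (x == v).
    by rewrite (eqP lv); symmetry; exact: twist_braid_letter.
  case lu: (x == u).
    by rewrite (eqP lu); apply: twist_braid_letter; rewrite adj_sym.
  by rewrite /= !twist_letter lu lv /= !twist_letter lu lv /= !twist_letter lu
    lv.
- by do !apply: comp_morph; exact: twist_morph.
- by do !apply: comp_morph; exact: twist_morph.
Qed.

(** * Elements whose reduced word runs around a circle *)

Lemma twist_insert v b n w :
  twist v b n (fclass w) = fclass (insert (twist_pre v b n) w).
Proof.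
elim: w => [|[l x] w IHw]; first by case: (twist_morph v b n).
rewrite fclass_cons twistM IHw insert_cons -[_ :: right_part _ _ ++ _]cat_cons.
rewrite catA fclass_cat; congr (_ * _).
have cl : twist v b n (letter l) =
  fclass (twist_pre v b n l) * letter l by exact: pres_lift_gen.
case: x; rewrite /left_part /right_part /= ?cl ?fclass_cat //.
have cV : fclass [:: (l, false)] =
  (letter l)^-1 by exact: (fclass_inv [:: (l, true)]).
rewrite [RHS]fclass_cons fclass_inv cV -invgM -cl.
exact: (spow_morph false 1%N _ (twist_morph v b n)).
Qed.

Lemma fword_twist v b n x :
  fword (twist v b n x) = nf (insert (twist_pre v b n) (fword x)).
Proof. by rewrite -{1}(fclass_fword x) twist_insert fword_fclass. Qed.

(** The path w passes from the arc k straight on to the arc l, in one direction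
    or the other. *)
Definition consecutive (k l : L) (w : word L) :=
  (exists z1 z2, w = z1 ++ (k, true) :: (l, true) :: z2) \/
  (exists z1 z2, w = z1 ++ (l, false) :: (k, false) :: z2).

Lemma consecutive_cat k l z1 w z2 :
  consecutive k l w -> consecutive k l (z1 ++ w ++ z2).
Proof.
by case=> -[y1 [y2 ->]]; [left | right]; exists (z1 ++ y1), (y2 ++ z2);
  rewrite -!catA.
Qed.

Lemma consecutive_inv k l w : consecutive k l w -> consecutive k l (word_inv w).
Proof.
by case=> -[y1 [y2 ->]]; [right | left]; exists (word_inv y2), (word_inv y1);
  rewrite word_inv_cat -[_ :: _ :: y2]/([:: _; _] ++ y2) word_inv_cat -catA.
Qed.

(** Two turns are needed: the arc at which a single turn starts has no
    predecessor in it. *)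
Lemma consecutive_wpow b n u v w : (1 < n)%N -> w \in e ->
  exists w', consecutive (v, w') (v, w) (wpow b n (circle v u)).
Proof.
case: n => [|[|n]] // _ we.
have wu : w \in cyclic_from u by rewrite mem_cat orbC -mem_cat cat_take_drop.
have [q1 [q2 cw]] : exists q1 q2, cyclic_from u = q1 ++ w :: q2.
  by case/splitPr: wu => q1 q2; exists q1, q2.
have [q [w' qw']] : exists q w', (w :: q2) ++ q1 = rcons q w'.
  by exists (belast w (q2 ++ q1)), (last w (q2 ++ q1)); rewrite -lastI.
exists w'; suffices sw : consecutive (v, w') (v, w) (flatten (nseq n.+2 (circle
  v u))).
  by case: b => //; exact: consecutive_inv.
pose f w0 : L * bool := ((v, w0), true).
left; exists (map f (q1 ++ q)), (map f q2 ++ flatten (nseq n (circle v u))).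
have -> : flatten (nseq n.+2 (circle v u)) =
    map f (cyclic_from u ++ cyclic_from u) ++ flatten (nseq n (circle v u)).
  by rewrite map_cat -catA.
rewrite -!cat_cons catA; congr (_ ++ _).
rewrite -[f w' :: _]/(map f (w' :: w :: q2)) -map_cat; congr map.
by rewrite cw -!catA (catA (w :: q2)) qw' -cats1 -!catA.
Qed.

Lemma reduced_circle_pow b n u v : reduced (wpow b n (circle v u)).
Proof.
suffices red k : reduced (flatten (nseq k (circle v u))).
  by case: b; [exact: red | apply: reduced_inv; exact: red].
have pos : all (fun a : L * bool => a.2) (flatten (nseq k (circle v u))).
  by elim: k => //= k IHk; rewrite all_cat IHk andbT /circle all_map;
    apply/allP.
elim: (flatten _) pos => //= a [|b' w] IHw //= /and3P[a2 b2 w2].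
rewrite /reduced /= -[path _ b' w]/(reduced (b' :: w)) IHw /= ?b2 // andbT.
by case: a b' a2 b2 {IHw} => l1 x1 [l2 x2] /= -> ->;
  rewrite /flip xpair_eqE andbF.
Qed.

(** The reduced word of x goes along the circle of v straight across the
    circles of all the neighbours of v. *)
Definition twisted v (x : F) :=
  forall u, adj u v -> exists w, consecutive (v, w) (v, u) (fword x).

Let pre_owned v b n (l : L) : l.1 == v -> twist_pre v b n l = [::].
Proof. by move=> /eqP lv; rewrite /twist_pre lv adj_irr andbF. Qed.

Let owned_pre v b n (l : L) :
  all (fun a : L * bool => a.1.1 == v) (twist_pre v b n l).
Proof.
rewrite /twist_pre; case: ifP => // _; rewrite /wpow.
have own : all (fun a : L * bool => a.1.1 == v) (flatten (nseq n (circle v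
  l.1))).
  elim: n => //= n IHn; rewrite all_cat IHn andbT /circle all_map.
  by apply/allP => w _ /=.
by case: b => //; rewrite /word_inv all_rev all_map.
Qed.

Lemma wpow_inv b n w : word_inv (wpow b n w) = wpow (~~ b) n w.
Proof. by case: b; rewrite /wpow ?word_invK. Qed.

(** No letters of the circle of u lie between two consecutive arcs of another
    circle. So the twist inserts there exactly the turns around u that belong
    to this crossing, or nothing if the circles do not cross there. *)
Lemma consecutive_twist u b n v w t x :
  v != u -> consecutive (v, w) (v, t) (fword x) ->
  exists z1 z z2, fword (twist u b n x) = z1 ++ z ++ z2 /\
    (if (t == u) && adj v u then exists b', z = wpow b' n (circle u v)
     else consecutive (v, w) (v, t) z).
Proof.
move=> vu sx; rewrite fword_twist.
have gap := nf_insert_gap (@pre_owned u b n) (@owned_pre u b n).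
have rx := reduced_fword x.
case: sx => -[z1 [z2 xE]]; rewrite xE in rx *.
  have [//|//|y1 [y2 ->]] := gap _ _ _ _ _ _ rx.
  rewrite /left_part /right_part /= /twist_pre /=; case: ifP => _.
    rewrite nf_id ?reduced_circle_pow //.
    exists (y1 ++ [:: ((v, w), true)]), (wpow b n (circle u v)), (((v, t),
      true) :: y2).
    by rewrite -catA; split=> //; exists b.
  exists y1, [:: ((v, w), true); ((v, t), true)], y2; split=> //.
  by left; exists [::], [::].
have [//|//|y1 [y2 ->]] := gap _ _ _ _ _ _ rx.
rewrite /left_part /right_part /= /twist_pre /=; case: ifP => _.
  rewrite cats0 wpow_inv nf_id ?reduced_circle_pow //.
  exists (y1 ++ [:: ((v, t), false)]), (wpow (~~ b) n (circle u v)), (((v, w),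
    false) :: y2).
  by rewrite -catA; split=> //; exists (~~ b).
exists y1, [:: ((v, t), false); ((v, w), false)], y2; split=> //.
by right; exists [::], [::].
Qed.

Lemma twisted_keep u b n v x : v != u -> adj v u = false ->
  twisted v x -> twisted v (twist u b n x).
Proof.
move=> vu Avu vx t tv; have [w sx] := vx t tv; exists w.
have [z1 [z [z2 [-> ]]]] := consecutive_twist b n vu sx.
by rewrite Avu andbF; exact: consecutive_cat.
Qed.

(** The word of x goes straight across the circle of u, and there the twist
    inserts at least two turns around u, which pass all the arcs of that
    circle. *)
Lemma twisted_enter u b n v x : adj u v -> (1 < n)%N ->
  twisted v x -> twisted u (twist u b n x).
Proof.
move=> uv n1 vx t tu; have [w sx] := vx u uv.
have vu : v != u by apply: contraTneq uv => ->; rewrite adj_irr.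
have [z1 [z [z2 [-> ]]]] := consecutive_twist b n vu sx.
rewrite eqxx adj_sym uv => -[b' ->].
have [w' sw] := consecutive_wpow b' v u n1 (adj_e tu); exists w'.
exact: consecutive_cat.
Qed.

Lemma twisted_letter u b n v : adj u v -> (1 < n)%N ->
  twisted v (twist v b n (letter (u, v))).
Proof.
move=> uv n1 t tv; have [w sw] := consecutive_wpow b u v n1 (adj_e tv);
  exists w.
rewrite twist_letter /= eqxx uv -fclass_wpow -fclass_cat fword_fclass nf_id.
  exact: (@consecutive_cat _ _ [::]).
apply: (@reduced_own_cat _ (pred1 v \o fst)) => //=.
- by have := owned_pre v b n (u, v); rewrite /twist_pre /= eqxx uv.
- by apply: contraTneq uv => ->; rewrite adj_irr.
- exact: reduced_circle_pow.
Qed.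

Lemma letter_not_twisted u v l : adj u v -> ~ twisted v (letter l).
Proof.
move=> uv /(_ u uv)[w]; rewrite fword_fclass /=.
by case=> -[z1 [z2 /(congr1 size)]]; rewrite size_cat /= !addnS.
Qed.

End Twists.

(** * Unfolding a Coxeter graph into a bipartite graph without labels *)

Lemma big_nat_blocks (G : groupType) (f : nat -> G) l n :
  \prod_(0 <= i < n * l) f i =
  \prod_(0 <= b < n) \prod_(0 <= j < l) f (b * l + j)%N.
Proof.
elim: n => [|n IHn]; first by rewrite mul0n !big_geq.
rewrite big_nat_recr //= -IHn (big_cat_nat (n := n * l)) ?leq_mul //=.
congr (_ * _); rewrite -{1}[(n * l)%N]add0n big_addn -mulnBl subSnn mul1n.
by apply: eq_bigr => j _; rewrite addnC.
Qed.

Section Unfolding.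
Variables (S : finType) (M : coxeter_matrix S).

(** [None] is an auxiliary generator, joined to all the others by an edge
    labelled 3, so that no circle is without crossings. Infinite labels count
    as 3. The value 1 on the diagonal makes paths without edges. *)
Definition path_size (x y : option S) :=
  if x == y then 1%N
  else if (x, y) is (Some s, Some t) then if M s t is Some m then m.-1 else 2
  else 2.

(** A common multiple of the path sizes, so that the copies split evenly into
    paths for each pair of generators. *)
Definition copies := (\prod_(xy : option S * option S) path_size xy.1 xy.2)%N.

Lemma path_size_sym x y : path_size x y = path_size y x.
Proof.
by rewrite /path_size eq_sym; case: x y => [s|] [t|] //; rewrite cox_sym.
Qed.

Lemma path_size_refl x : path_size x x = 1%N.
Proof. by rewrite /path_size eqxx. Qed.

Lemma path_size_gt0 x y : (0 < path_size x y)%N.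
Proof.
rewrite /path_size; case: eqP => // /eqP; case: x y => [s|] [t|] // xy.
case Mst: (M s t) => [m|//]; have := cox_offdiag (s := s) (t := t) xy Mst.
by case: m {Mst} => [|[]].
Qed.

Lemma path_size_dvd x y : path_size x y %| copies.
Proof. by rewrite /copies (bigD1 (x, y)) //= dvdn_mulr. Qed.

Lemma copies_gt0 : (0 < copies)%N.
Proof. by apply: prodn_gt0 => xy; exact: path_size_gt0. Qed.

Notation V := (option S * nat)%type.

Definition vertices : seq V :=
  [seq (x, p) | x <- enum {: option S}, p <- iota 0 copies].

(** The copies of x and y at consecutive positions are joined unless a boundary
    between blocks of [path_size x y] positions separates them. Edges change
    the parity of the position, so the graph is bipartite, and for each of the
    two ways to match the generators x, y with the parities each block gives
    one path. *)
Definition adj (u v : V) :=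
  [&& (u.2 < copies)%N, (v.2 < copies)%N, (u.2.+1 == v.2) || (v.2.+1 == u.2)
    & u.2 %/ path_size u.1 v.1 == v.2 %/ path_size u.1 v.1].

Definition side (v : V) := odd v.2.

Lemma vertices_uniq : uniq vertices.
Proof.
by apply: allpairs_uniq; rewrite ?enum_uniq ?iota_uniq // => -[x p] [y q] _ _.
Qed.

Lemma adj_vertices u v : adj u v -> u \in vertices.
Proof.
by case: u => x p /and4P[/= pK _ _ _]; rewrite allpairs_f ?mem_enum ?mem_iota.
Qed.

Lemma adj_sym : symmetric adj.
Proof.
move=> u v; rewrite /adj orbC (path_size_sym u.1) [_ %/ _ == _]eq_sym.
by rewrite !andbA [(u.2 < copies)%N && _]andbC.
Qed.

Lemma adj_side u v : adj u v -> side v = ~~ side u.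
Proof.
rewrite /side => /and4P[_ _ + _].
by case/orP=> /eqP <- /=; rewrite ?negbK.
Qed.

Lemma adj_path_size1 x y p q : path_size x y = 1%N -> adj (x, p) (y, q) = false.
Proof. by move=> l1; rewrite /adj /= l1 !divn1; apply/negP; lia. Qed.

(** In a block with at least two positions, take the previous position, or the
    next one at the start of the block. *)
Lemma adj_neighbour x y q : (1 < path_size x y)%N -> (q < copies)%N ->
  exists2 p, (p < copies)%N & adj (x, p) (y, q).
Proof.
move=> l1 qK; have [N copiesE] := dvdnP (path_size_dvd x y).
set l := path_size x y in l1 copiesE *; have l0 := ltnW l1.
have rl := ltn_pmod q l0.
have aN : (q %/ l < N)%N by rewrite ltn_divLR // -copiesE.
have qdiv r : (r < l)%N -> ((q %/ l * l + r) %/ l = q %/ l)%N.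
  by move=> r_l; rewrite divnMDl // (divn_small r_l) addn0.
have aK r : (r < l)%N -> (q %/ l * l + r < copies)%N.
  by move=> r_l; rewrite copiesE -ltn_divLR // qdiv.
case: (posnP (q %% l)) => r0; last first.
  have p1 : q.-1 = (q %/ l * l + (q %% l).-1)%N.
    by rewrite {1}(divn_eq q l) -(prednK r0) addnS.
  have rl' : ((q %% l).-1 < l)%N := leq_ltn_trans (leq_pred _) rl.
  exists q.-1; first by rewrite p1 aK.
  have q0 : (0 < q)%N by rewrite lt0n; apply: contraTneq r0 => ->;
    rewrite mod0n.
  apply/and4P; split=> //=.
  - by rewrite p1 aK.
  - by rewrite prednK ?eqxx.
  - by rewrite -/l p1 qdiv.
have p1 : q.+1 = (q %/ l * l + 1)%N by rewrite {1}(divn_eq q l) r0 addn0 addn1.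
exists q.+1; first by rewrite p1 aK.
apply/and4P; split=> //=.
- by rewrite p1 aK.
- by rewrite eqxx orbT.
- by rewrite -/l p1 qdiv.
Qed.

(** * The representation of the Artin group by twists *)

Notation F := (free_group (V * V)%type).
Notation vertex_twist := (twist_bij vertices adj_side).

Definition copy_twist (s : S) p : bij F := vertex_twist (Some s, p).
Definition generator_image (s : S) : bij F :=
  \prod_(0 <= p < copies) copy_twist s p.

Lemma copy_twist_commute s t p q :
  adj (Some s, p) (Some t, q) = false ->
    commute (copy_twist s p) (copy_twist t q).
Proof. exact: twist_bij_commute adj_sym _ _ _. Qed.

Lemma copy_twist_commute_same s p q : commute (copy_twist s p) (copy_twist s q).
Proof.
by apply: copy_twist_commute; rewrite adj_path_size1 ?path_size_refl.
Qed.

Section Block.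
Variables (s t : S) (b : nat).
Let l := path_size (Some s) (Some t).
Hypothesis b_small : (b.+1 * l <= copies)%N.

(** The two paths in the block b, according to which of s and t has its copies
    at even offsets. *)
Definition zigzag c j := copy_twist (if odd j == c then s else t) (b * l + j)%N.

Lemma block_far c d i j :
    (i.+1 != j) && (j.+1 != i) || ((odd i == c) == (odd j == d)) ->
  commute (zigzag c i) (zigzag d j).
Proof.
move=> ij; apply: copy_twist_commute; apply/negP=> A;
  move: (A) => /and4P[_ _ /= ji _].
case/orP: ij => [|/eqP cd]; first by case/orP: ji => /eqP; lia.
by move: A; rewrite cd adj_path_size1 ?path_size_refl.
Qed.

Lemma block_near c i : (i.+1 < l)%N ->
  zigzag c i * zigzag c i.+1 * zigzag c i =
    zigzag c i.+1 * zigzag c i * zigzag c i.+1.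
Proof.
move=> il; apply: (twist_bij_braid vertices_uniq adj_vertices adj_sym);
  have l0 : (0 < l)%N by exact: path_size_gt0.
have blK r : (r < l)%N -> (b * l + r < copies)%N.
  by move=> rl; apply: leq_trans b_small; rewrite mulSn addnC ltn_add2r.
apply/and4P; split=> /=; rewrite ?blK ?(ltnW il) //;
  first by rewrite addnS eqxx.
have -> : path_size (Some (if odd i == c then s else t))
                    (Some (if ~~ odd i == c then s else t)) = l.
  by rewrite /l; case: (odd i) c => [] [] //=; rewrite path_size_sym.
by rewrite !divnMDl // !divn_small // ltnW.
Qed.

Lemma block_split c :
  \prod_(0 <= j < l) copy_twist (if c then s else t) (b * l + j)%N =
  parity_row (zigzag c) 0 l 1 * parity_row (zigzag (~~ c)) 0 l 0.
Proof.
rewrite /parity_row [X in _ = X * _]big_mkcond [X in _ = _ * X]big_mkcond.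
rewrite -prodgM_commute.
  apply: eq_bigr => j _; rewrite /zigzag /=.
  by case: (odd j) c => [] [] /=; rewrite ?mulg1 ?mul1g.
move=> i j _ _; case: ifP => [/eqP oi | _]; last exact/commute_sym/commute1.
case: ifP => [/eqP oj | _]; last exact: commute1.
by apply: block_far; rewrite oi oj; case: c; rewrite !orbT.
Qed.

Lemma block_alt_comm :
  alt_comm l.+1 (\prod_(0 <= j < l) copy_twist s (b * l + j)%N)
                (\prod_(0 <= j < l) copy_twist t (b * l + j)%N).
Proof.
have far c i j : (i.+1 < j)%N -> commute (zigzag c i) (zigzag c j).
  by move=> ij; apply: block_far; apply/orP; left; lia.
have rel c :
    alt_comm l.+1 (parity_row (zigzag c) 0 l 0) (parity_row (zigzag c) 0 l 1).
  exact: (path_alt_comm (@far c) (@block_near c) (a := 0) (n := l) (leqnn l)).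
have cross k k' :
    commute (parity_row (zigzag false) 0 l k) (parity_row (zigzag true) 0 l k').
  apply: commute_prod => j _; apply: commute_sym; apply: commute_prod => i _.
  apply: block_far; case: (boolP (odd i == odd j)) => [/eqP ij|].
    by apply/orP; left; apply/andP; split; apply/eqP=> eij; move: ij;
      rewrite -eij /=; case: odd.
  by move=> ij; apply/orP; right; case: (odd i) (odd j) ij => [] [].
rewrite (block_split true) (block_split false) /= -(cross 0 1%N).
by apply: alt_commM; [exact: cross.. | exact: rel | exact: esym (rel true)].
Qed.

End Block.

(** The two products split over the blocks and then over the two paths in each
    block; on a path with m - 1 vertices the relation has length m. *)
Lemma generator_image_alt_comm s t m :
  M s t = Some m -> alt_comm m (generator_image s) (generator_image t).
Proof.
case: (eqVneq s t) => [-> // | neq_st Mst].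
have l_m : m = (path_size (Some s) (Some t)).+1.
  have := cox_offdiag neq_st Mst;
    rewrite /path_size /= (inj_eq Some_inj) (negbTE neq_st) Mst.
  by case: m {Mst}.
have [n copiesE] := dvdnP (path_size_dvd (Some s) (Some t)).
rewrite l_m /generator_image copiesE !big_nat_blocks; apply: alt_comm_prod;
  first exact: iota_uniq.
  move=> b b' neq_b; set l := path_size _ _.
  have far i j : (i < l)%N -> (j < l)%N ->
      commute (copy_twist s (b * l + i)%N) (copy_twist t (b' * l + j)%N).
    move=> il jl; apply: copy_twist_commute; apply/negP=> /and4P[_ _ _ /=].
    by rewrite -/l !divnMDl ?path_size_gt0 // !divn_small // !addn0 (negbTE
      neq_b).
  have same s' : commute (\prod_(0 <= j < l) copy_twist s' (b * l + j)%N)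
                         (\prod_(0 <= j < l) copy_twist s' (b' * l + j)%N).
    apply: commute_prod => j _; apply: commute_sym; apply: commute_prod => i _.
    exact: copy_twist_commute_same.
  split=> //; rewrite !big_nat; apply: commute_prod => j /andP[_ jl].
  by apply: commute_sym; apply: commute_prod => i /andP[_ il];
    apply/commute_sym/far.
move=> b; rewrite mem_index_iota => /andP[_ bn]; apply: block_alt_comm => //.
by rewrite copiesE leq_mul2r bn orbT.
Qed.

Lemma eval_prod_word (G : groupType) (f : S -> G) s t m :
  eval_word f (prod_word s t m) = alt (f s) (f t) m.
Proof.
have step n :
    prod_word s t n.+2 = [:: pos_letter s; pos_letter t] ++ prod_word s t n.
  by rewrite /prod_word /= negbK.
have [n] := ubnP m; elim: n => // n IHn in m *; case: m => [|[|m]] mn.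
- by rewrite /eval_word big_nil.
- by rewrite /eval_word /prod_word /= big_cons big_nil.
- have{mn} mn : (m < n)%N by apply: ltnW; rewrite -ltnS.
  rewrite step eval_word_cat (IHn m mn) /eval_word !big_cons big_nil mulg1.
  by rewrite -mulgA.
Qed.

Lemma generator_image_respects : respects_rel (artin_rel M) generator_image.
Proof.
by move=> _ _ [s t m Mst]; rewrite !eval_prod_word;
  exact: generator_image_alt_comm.
Qed.

Definition twist_rep : artin_group M -> bij F :=
  pres_lift generator_image_respects.

Lemma twist_rep_morph : monoid_morphism twist_rep.
Proof. exact: pres_lift_monoid_morphism. Qed.

Lemma twist_rep_sigma s : twist_rep (sigma M s) = generator_image s.
Proof. exact: pres_lift_gen. Qed.

(** * Squares of the generators play ping-pong *)

Definition artin_commute2 s t := M s t == Some 2.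

(** The domain of the generator s in the ping-pong argument. *)
Definition twisted_over s x :=
  exists2 p, (p < copies)%N & twisted adj (Some s, p) x.

Lemma spow_twist_bij v b n x :
  (spow b n (vertex_twist v) : bij F) x =
    twist vertices adj v (if b then side v else ~~ side v) n x.
Proof. by case: b; rewrite /spow ?twist_bijX ?twist_bijVX. Qed.

(** Generators whose squares need not commute have adjacent copies. *)
Lemma path_size_gt1 s t : s != t -> ~~ artin_commute2 s t ->
  (1 < path_size (Some s) (Some t))%N.
Proof.
move=> st; rewrite /artin_commute2 /path_size (inj_eq Some_inj) (negbTE st).
case Mst: (M s t) => [m|//]; have := cox_offdiag st Mst.
by case: m {Mst} => [|[|[]]].
Qed.

(** The twists of the copies of s commute, so the one that produces the turns
    may act first; the circles of the other copies do not meet its circle. *)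
Lemma generator_image_enter s b n p x : (p < copies)%N ->
  twisted adj (Some s, p) ((spow b n (copy_twist s p) : bij F) x) ->
  twisted_over s ((spow b n (generator_image s) : bij F) x).
Proof.
move=> pK px; rewrite /generator_image spow_prod;
  last exact: copy_twist_commute_same.
have [|||r pr ->] := @prod_to_end _ _ (index_iota 0 copies)
  (fun p => spow b n (copy_twist s p)) p.
- by move=> q q'; apply: commute_spow; exact: copy_twist_commute_same.
- exact: iota_uniq.
- by rewrite mem_index_iota.
exists p => //; rewrite bij_mulE; move: (bij_fun _ x) px => y py.
elim: r pr => [|q r IHr]; first by rewrite big_nil.
rewrite inE negb_or => /andP[pq /IHr{}IHr];
  rewrite big_cons bij_mulE spow_twist_bij.
apply: twisted_keep IHr; first exact: adj_side.
  by rewrite xpair_eqE negb_and pq orbT.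
by rewrite adj_path_size1 ?path_size_refl.
Qed.

Lemma twisted_over_enter s t b n x :
  s != t -> ~~ artin_commute2 s t -> (1 < n)%N ->
  twisted_over t x -> twisted_over s ((spow b n (generator_image s) : bij F) x).
Proof.
move=> st cst n1 [q qK qx].
have [p pK A] := adj_neighbour (path_size_gt1 st cst) qK.
apply: (generator_image_enter pK); rewrite spow_twist_bij.
exact (twisted_enter adj_vertices adj_sym adj_side _ A n1 qx).
Qed.

Lemma twisted_over_keep s t b n x : s != t -> artin_commute2 s t ->
  twisted_over t x -> twisted_over t ((spow b n (generator_image s) : bij F) x).
Proof.
move=> st cst [q qK qx]; exists q => //.
rewrite /generator_image spow_prod; last exact: copy_twist_commute_same.
elim: (index_iota 0 copies) => [|p r IHr]; first by rewrite big_nil.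
rewrite big_cons bij_mulE spow_twist_bij; apply: twisted_keep IHr;
  first exact: adj_side.
  by rewrite xpair_eqE negb_and (inj_eq Some_inj) eq_sym st.
rewrite adj_sym adj_path_size1 // /path_size (inj_eq Some_inj) (negbTE st).
by rewrite (eqP cst).
Qed.

Lemma auxiliary_neighbour s :
  exists p, (p < copies)%N && adj (None, p) (Some s, 0%N).
Proof.
have [p pK A] := @adj_neighbour None (Some s) 0 isT copies_gt0.
by exists p; rewrite pK.
Qed.

(** An arc of an auxiliary circle that starts on the circle of a copy of s: the
    twist along this copy attaches turns to it. *)
Definition probe s : F :=
  fclass [:: ((None, xchoose (auxiliary_neighbour s)), (Some s, 0%N), true)].

Lemma probe_enters s b n : (1 < n)%N ->
  twisted_over s ((spow b n (generator_image s) : bij F) (probe s)).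
Proof.
have /andP[pK A] := xchooseP (auxiliary_neighbour s); move=> n1.
apply: (generator_image_enter copies_gt0); rewrite spow_twist_bij.
exact (twisted_letter adj_vertices adj_side _ A n1).
Qed.

Lemma probe_not_twisted s t : ~ twisted_over s (probe t).
Proof.
case=> p pK; have [q qK A] := @adj_neighbour None (Some s) p isT pK.
exact: letter_not_twisted A.
Qed.

Lemma syllables_pres_class (u : word S) :
  exists n, syllables (Q M) n (pres_class (@square_rel S M) u).
Proof.
elim: u => [|[s b] u [n IHu]]; first by exists 0%N.
exists n.+1, s, b, 1%N, (pres_class (@square_rel S M) u); split=> //.
rewrite -cat1s [LHS]pres_classM; congr (_ * _).
by rewrite [LHS]pres_class_letter; case: b.
Qed.

End Unfolding.

Theorem corollary2 (S : finType) (M : coxeter_matrix S) :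
  injective (square_hom M : square_group M -> artin_group M).
Proof.
apply: gmulf_inj => g g1.
have [n sg] := syllables_pres_class M (pres_repr g).
rewrite pres_reprK in sg.
have [rho1 rhoM] := twist_rep_morph M.
pose act g := bij_fun (twist_rep (square_hom M g)).
have actM g' h x : act (g' * h) x = act g' (act h x).
  by rewrite /act gmulfM rhoM.
have actQ s b k : act (spow b k (Q M s)) =
  bij_fun (spow b (2 * k) (generator_image M s)).
  have sqM : monoid_morphism (square_hom M).
    by split; [exact: gmulf1 | exact: gmulfM].
  rewrite /act (spow_morph b k _ sqM) (spow_morph _ _ _ (twist_rep_morph M))
    square_homQ.
  by rewrite expg2 rhoM twist_rep_sigma -expg2 spowX.
(* A nontrivial power of a square is at least two full twists. *)
have two k : (0 < k)%N -> (1 < 2 * k)%N by case: k => // k _; rewrite mulnS.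
apply: (ping_pong (comm := artin_commute2 M) _ _ actM
  (base := @probe _ M) (dom := @twisted_over _ M)) sg _.
- by move=> s t; rewrite /artin_commute2 cox_sym.
- move=> s t /eqP st; rewrite /commute -[LHS]pres_classM -[RHS]pres_classM.
  exact/pres_classP/pres_rel/SquareRel.
- by move=> s t b k x st cst /two k1; rewrite actQ; exact: twisted_over_enter.
- by move=> s t b k x st cst; rewrite actQ; exact: twisted_over_keep.
- by move=> s b k /two k1; rewrite actQ; exact: probe_enters.
- exact: probe_not_twisted.
- by move=> x; rewrite /act g1 rho1.
Qed.
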